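(* Let $G$ be a finite, simple, connected graph with minimum degree $\delta(G) \geq 2$ and maximum degree $\Delta(G)$. Then $$M'_D(G) \leq \left\lceil \sqrt{\Delta(G)} \right\rceil + 5.$$
   Context: All graphs are finite, simple and undirected. An edge coloring $c : E(G) \to [k]$ is a majority edge coloring if for every vertex $u$ and every color $\alpha \in [k]$, at most half of the edges incident with $u$ have color $\alpha$ (the coloring need not be proper). An automorphism $\varphi$ of $G$ preserves $c$ if $c(\varphi(u)\varphi(v)) = c(uv)$ for every edge $uv$. An edge coloring is distinguishing if the only automorphism of $G$ preserving it is the identity. The majority distinguishing index $M'_D(G)$ is the smallest number of colors in an edge coloring of $G$ that is both a majority edge coloring and distinguishing. *)

(* Defs.v *)
From mathcomp Require Import all_boot all_order all_algebra all_fingroup.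

Set Implicit Arguments.
Unset Strict Implicit.
Unset Printing Implicit Defensive.

Record sgraph := SGraph {
  vertex :> finType;
  adj : rel vertex;
  adj_sym : symmetric adj;
  adj_irrefl : irreflexive adj
}.

Definition is_edge (G : sgraph) (A : {set G}) : bool :=
  [exists u : G, exists v : G, adj u v && (A == [set u; v])].

Definition edge (G : sgraph) : finType := {A : {set G} | is_edge A}.

Definition degree (G : sgraph) (u : G) : nat := #|[set v : G | adj u v]|.

Definition max_degree (G : sgraph) : nat := \max_(u : G) degree u.

(* Every degree is smaller than #|G|, so the neutral value #|G| is only reached
   when G has no vertex. *)
Definition min_degree (G : sgraph) : nat :=
  \big[minn/#|G|]_(u : G) degree u.

(* The graph without vertices is not connected. *)
Definition connected (G : sgraph) : bool :=
  (0 < #|G|) && [forall u : G, forall v : G, connect (@adj G) u v].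

Definition incident (G : sgraph) (u : G) : {set edge G} :=
  [set e : edge G | u \in val e].

Definition edge_coloring (G : sgraph) (k : nat) : finType :=
  {ffun edge G -> 'I_k}.

Definition majority (G : sgraph) (k : nat) (c : edge_coloring G k) : bool :=
  [forall u : G, forall a : 'I_k,
     2 * #|[set e in incident u | c e == a]| <= #|incident u|].

Definition automorphism (G : sgraph) (phi : {perm G}) : bool :=
  [forall u : G, forall v : G, adj (phi u) (phi v) == adj u v].

(* When phi is an automorphism, the image of an edge e = {u, v} is the edge
   e' = {phi u, phi v}; e' is quantified to avoid a dependent construction. *)
Definition preserves (G : sgraph) (k : nat) (c : edge_coloring G k)
    (phi : {perm G}) : bool :=
  [forall e : edge G, forall e' : edge G,
     (val e' == [set phi x | x in val e]) ==> (c e' == c e)].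

Definition distinguishing (G : sgraph) (k : nat) (c : edge_coloring G k) : bool :=
  [forall phi : {perm G},
     (automorphism phi && preserves c phi) ==> (phi == 1%g)].

Definition md_colorable (G : sgraph) (k : nat) : bool :=
  [exists c : edge_coloring G k, majority c && distinguishing c].

(* Not every graph has a majority distinguishing edge coloring (an isolated edge
   has none), hence the existence argument. *)
Definition majority_distinguishing_index (G : sgraph)
    (exG : exists k, md_colorable G k) : nat := ex_minn exG.

Section Existence.

Variable G : sgraph.

Lemma is_edge_adj (u v : G) : adj u v -> is_edge [set u; v].
Proof.
move=> uv; apply/existsP; exists u; apply/existsP; exists v.
by rewrite uv eqxx.
Qed.

Lemma min_degree_le (u : G) : min_degree G <= degree u.
Proof.
rewrite /min_degree; have := mem_index_enum u.
elim: (index_enum _) => // x s IH; rewrite inE big_cons geq_min.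
by case/orP => [/eqP ->|/IH ->]; rewrite ?leqnn ?orbT.
Qed.

Lemma degree_le_incident (u : G) : degree u <= #|incident u|.
Proof.
pose f (e : edge G) : {set G} := val e.
have fI : injective f by apply: val_inj.
rewrite -(card_imset _ fI) /degree.
pose g (v : G) : {set G} := [set u; v].
have gI : {in [set v : G | adj u v] &, injective g}.
  move=> v w; rewrite !inE => uv uw /setP /(_ v); rewrite !inE eqxx orbT.
  move=> /esym /orP [/eqP vu|/eqP //].
  by move: uv; rewrite vu adj_irrefl.
rewrite -(card_in_imset gI); apply/subset_leq_card/subsetP => A.
case/imsetP => v; rewrite inE => uv ->; apply/imsetP.
by exists (Sub [set u; v] (is_edge_adj uv)); rewrite ?inE /f /= ?inE ?eqxx.
Qed.

Lemma md_colorable_card_edge : 2 <= min_degree G -> md_colorable G #|edge G|.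
Proof.
move=> deg2; apply/existsP; exists [ffun e : edge G => enum_rank e].
apply/andP; split.
  apply/forallP => u; apply/forallP => a.
  have le1 : #|[set e in incident u |
      [ffun e : edge G => enum_rank e] e == a]| <= 1.
    rewrite -(cards1 (enum_val a)); apply/subset_leq_card/subsetP => e.
    by rewrite !inE ffunE => /andP [_ /eqP <-]; rewrite enum_rankK.
  apply: (leq_trans (leq_mul (leqnn 2) le1)).
  exact: leq_trans (leq_trans deg2 (min_degree_le u)) (degree_le_incident u).
apply/forallP => phi; apply/implyP => /andP [/forallP aut /forallP pres].
have fixe (u v : G) : adj u v -> phi u \in [set u; v].
  move=> uv.
  have puv : adj (phi u) (phi v) by rewrite (eqP (forallP (aut u) v)).
  pose e : edge G := Sub [set u; v] (is_edge_adj uv).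
  pose e' : edge G := Sub [set phi u; phi v] (is_edge_adj puv).
  have := implyP (forallP (pres e) e').
  rewrite /= imsetU1 imset_set1 eqxx => /(_ isT).
  rewrite !ffunE => /eqP /enum_rank_inj /(congr1 val) /= <-.
  by rewrite !inE eqxx.
apply/eqP/permP => u; rewrite perm1.
have := leq_trans deg2 (min_degree_le u); rewrite /degree cardsE.
move=> /card_gt1P [v [w [uv uw vw]]].
have := fixe _ _ uv; have := fixe _ _ uw; rewrite !inE.
case/orP => [/eqP //|/eqP ->]; case/orP => [/eqP //|/eqP wv].
by rewrite wv eqxx in vw.
Qed.

Lemma md_colorable_ex : 2 <= min_degree G -> exists k, md_colorable G k.
Proof. by move=> deg2; exists #|edge G|; apply: md_colorable_card_edge. Qed.

End Existence.

(* Main.v *)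
Require Import Defs.
From mathcomp Require Import all_boot all_order all_algebra all_fingroup.
From mathcomp Require Import zify.

(* Order the vertices along a longest path r, a, ..., then by a search that
   always moves to an unvisited neighbor of the current vertex if there is one.
   Let p(u) be the smallest neighbor of u. An automorphism that fixes r and
   preserves the coloring fixes every vertex, by induction on the order, as soon
   as any two u, w with p(u) = p(w) differ in the color of the edge to p(u) or in
   the multiset of colors at the vertex. With s = ceil(sqrt Delta), at most s
   such siblings share the color of the edge to p(u); each u then owns a
   signature edge, colored last at u, which avoids the at most s - 1 multisets of
   its siblings. A greedy choice respecting majority forbids at most three more
   colors, so s + 3 colors suffice for these edges.
   Signature edges {u, h(u)} must be acyclic, so some vertices get none. A minimal
   set Z of local maxima hitting the possible targets serves as the set of sinks of
   h: its elements are told apart from the others by two additional star colors on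
   {p(z), z}, the second being used at v only after the first has been used
   floor(deg v / 2) times, and each of them is the only candidate seen from some
   vertex outside Z. The edge {r, a} gets the second star color too, and is the
   only such edge with at most one edge of the first star color at either end. *)

Set Implicit Arguments.
Unset Strict Implicit.
Unset Printing Implicit Defensive.

(** * Counting in finite sets *)

Lemma set2_inj (T : finType) (x y u v : T) :
  [set x; y] = [set u; v] -> (x = u /\ y = v) \/ (x = v /\ y = u).
Proof.
move=> /setP E; move: (E x) (E y) (E u) (E v); rewrite !inE !eqxx ?orbT /=.
move=> /esym/orP [/eqP -> | /eqP ->].
  move=> /esym/orP [/eqP -> | /eqP ->] _; last by left.
  by rewrite orbb => /eqP ->; left.
move=> /esym/orP [/eqP -> | /eqP ->]; first by right.
by rewrite orbb => /eqP ->; left.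
Qed.

Lemma card_sup_mul (T : finType) (f : T -> nat) (t : nat) :
  #|[set x | t <= f x]| * t <= \sum_x f x.
Proof.
rewrite -sum_nat_const big_mkcond /=.
by apply: leq_sum => x _; rewrite inE; case: ifP.
Qed.

Lemma exists_notin3 (T : finType) (A B C : {set T}) :
  #|A| + #|B| + #|C| < #|T| -> exists x, [/\ x \notin A, x \notin B & x \notin C].
Proof.
move=> lt; have : 0 < #|~: (A :|: B :|: C)|.
  have := cardsC (A :|: B :|: C); have := cardsU (A :|: B) C.
  have := cardsU A B; lia.
case/card_gt0P => x; rewrite !inE !negb_or => /andP [/andP [xA xB] xC].
by exists x.
Qed.

Lemma card_partition_color (T C : finType) (P : pred T) (c : T -> C) :
  \sum_(g : C) #|[set x | P x && (c x == g)]| = #|[set x | P x]|.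
Proof.
rewrite -sum1dep_card (partition_big c predT) //=.
by apply: eq_bigr => g _; rewrite sum1dep_card.
Qed.

(** Serves to cut the sinks with a common parent into those that receive the first star color and
    the rest. *)
Lemma card_index_lt (T : finType) (X : {set T}) (k : nat) :
  #|[set x in X | index x (enum X) < k]| = minn k #|X|.
Proof.
rewrite [#|X|]cardE -size_take_min.
have U : uniq (take k (enum X)) by rewrite take_uniq ?enum_uniq.
rewrite -(card_uniqP U); apply: eq_card => x; rewrite !inE.
rewrite -mem_enum; case: (boolP (x \in enum X)) => [/in_take -> // | xX].
by apply/esym/negP => /mem_take; apply/negP.
Qed.

(** Replaces the dependent type of edges by a function on all vertex sets, whose values off the
    edges do not matter, and allows any finite type of colors. *)
Lemma md_colorable_finType (G : sgraph) (T : finType) (f : {set G} -> T) :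
  (forall u t, 2 * #|[set v | adj u v && (f [set u; v] == t)]| <= degree u) ->
  (forall phi : {perm G}, (forall u v, adj (phi u) (phi v) = adj u v) ->
    (forall u v, adj u v -> f [set phi u; phi v] = f [set u; v]) -> phi = 1%g) ->
  md_colorable G #|T|.
Proof.
move=> maj rigid; apply/existsP; exists [ffun e => enum_rank (f (val e))].
apply/andP; split.
  apply/forallP => u; apply/forallP => i.
  apply: leq_trans (degree_le_incident u); apply: leq_trans (maj u (enum_val i)).
  rewrite leq_mul2l /= -(card_imset _ (@val_inj _ _ (edge G))).
  apply: leq_trans (leq_imset_card (fun v => [set u; v]) _).
  apply/subset_leq_card/subsetP => E /imsetP [e + ->].
  rewrite 2!inE ffunE => /andP [ue /eqP ei]; apply/imsetP.
  have /existsP [x /existsP [y /andP [xy /eqP Exy]]] := valP e.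
  move: ue ei; rewrite Exy => /set2P ue ei.
  have fi : f [set x; y] = enum_val i by rewrite -ei ?Exy enum_rankK -?Exy.
  case: ue => ->; first by exists y; rewrite // inE xy fi eqxx.
  by exists x; [rewrite inE adj_sym xy setUC fi eqxx | rewrite setUC].
apply/forallP => phi; apply/implyP => /andP [/forallP aut /forallP pres].
apply/eqP/rigid => [u v | u v uv]; first exact/eqP/(forallP (aut u) v).
have puv : adj (phi u) (phi v) by rewrite (eqP (forallP (aut u) v)).
pose e : edge G := Sub [set u; v] (is_edge_adj uv).
pose e' : edge G := Sub [set phi u; phi v] (is_edge_adj puv).
have := implyP (forallP (pres e) e').
rewrite /= imsetU1 imset_set1 eqxx => /(_ isT).
by rewrite !ffunE => /eqP /enum_rank_inj.
Qed.

(** * Partial edge colorings and the majority condition *)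

Section PartialColoring.

Variables (G : sgraph) (C : finType).
Implicit Types (D : {set {set G}}) (c : {set G} -> C) (u v : G).

(** [D] holds the edges already colored; the values of [c] elsewhere are meaningless. *)
Definition color_count D c u (g : C) : nat :=
  #|[set v | adj u v && ([set u; v] \in D) && (c [set u; v] == g)]|.

Definition recolor c (E : {set G}) (g : C) : {set G} -> C :=
  fun X => if X == E then g else c X.

Definition saturated D c u : {set C} :=
  [set g | (degree u)./2 <= color_count D c u g].

Lemma degree_minus1 u v (X : {set G}) :
  adj u v -> v \notin X -> X \subset [set w | adj u w] -> #|X| < degree u.
Proof.
move=> uv vX XN; apply: proper_card; apply/properP; split=> //.
by exists v; rewrite ?inE.
Qed.

Lemma degree_minus2 u v w (X : {set G}) :
  adj u v -> adj u w -> v != w -> v \notin X -> w \notin X ->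
  X \subset [set y | adj u y] -> #|X| + 2 <= degree u.
Proof.
move=> uv uw vw vX wX XN; have := @degree_minus1 u v (w |: X) uv.
rewrite !inE negb_or vw vX cardsU1 wX => /(_ isT); rewrite subUset sub1set inE uw XN.
by move=> /(_ isT); lia.
Qed.

Lemma sum_color_count D c u :
  \sum_g color_count D c u g = #|[set v | adj u v && ([set u; v] \in D)]|.
Proof.
exact: (card_partition_color (fun v => adj u v && ([set u; v] \in D))
  (fun v => c [set u; v])).
Qed.

(** Two saturated colors would take at least [degree u - 1] edges, but at most [degree u - 2] are
    colored. *)
Lemma card_saturated1 D c u v w :
  adj u v -> adj u w -> v != w -> [set u; v] \notin D -> [set u; w] \notin D ->
  #|saturated D c u| <= 1.
Proof.
move=> uv uw vw vD wD; have := card_sup_mul (color_count D c u) (degree u)./2.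
rewrite sum_color_count -/(saturated D c u).
have := @degree_minus2 u v w [set y | adj u y && ([set u; y] \in D)] uv uw vw.
rewrite !inE (negPf vD) (negPf wD) !andbF => /(_ isT isT) le.
have {le} := le _; have -> : [set y | adj u y && ([set u; y] \in D)]
  \subset [set y | adj u y] by apply/subsetP => y; rewrite !inE => /andP [].
move=> /(_ isT); nia.
Qed.

(** Three saturated colors would take at least [degree u] edges, since [3 * d./2 >= d] for [d >= 2],
    but one edge at [u] is uncolored. *)
Lemma card_saturated2 D c u v :
  2 <= degree u -> adj u v -> [set u; v] \notin D -> #|saturated D c u| <= 2.
Proof.
move=> du uv vD; have := card_sup_mul (color_count D c u) (degree u)./2.
rewrite sum_color_count -/(saturated D c u).
have := @degree_minus1 u v [set y | adj u y && ([set u; y] \in D)] uv.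
rewrite !inE (negPf vD) !andbF => /(_ isT) le.
have {le} := le _; have -> : [set y | adj u y && ([set u; y] \in D)]
  \subset [set y | adj u y] by apply/subsetP => y; rewrite !inE => /andP [].
move=> /(_ isT); nia.
Qed.

Lemma color_count_recolor D c E g u b :
  color_count (E |: D) (recolor c E g) u b
    <= color_count D c u b + ((u \in E) && (b == g)).
Proof.
pose X := [set v | ([set u; v] == E) && (b == g)].
apply: (@leq_trans #|[set v | adj u v && ([set u; v] \in D) && (c [set u; v] == b)]
   :|: X|).
  apply/subset_leq_card/subsetP => v; rewrite !inE /recolor.
  by case: eqVneq => [_ | _]; rewrite /= ?orbF // andbT eq_sym => /andP [_ ->]; rewrite orbT.
rewrite cardsU; apply: (leq_trans (leq_subr _ _)); rewrite leq_add2l.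
case: (boolP (_ && _)) => H.
  rewrite -ltnS ltnNge; apply/negP => /card_gt1P [v [w [+ + vw]]].
  rewrite !inE => /andP [/eqP <- _] /andP [/eqP /set2_inj [[_ wv]|[uv wu]]].
    by rewrite wv eqxx in vw.
  by rewrite wu uv eqxx in vw.
rewrite leqn0 cards_eq0; apply/eqP/setP => v; rewrite !inE.
apply/negP => /andP [/eqP EE bg]; case/negP: H.
by rewrite -EE !inE eqxx bg.
Qed.

Lemma color_count_recolor_sat D c x y g :
  (forall u b, color_count D c u b <= (degree u)./2) ->
  g \notin saturated D c x -> g \notin saturated D c y ->
  forall u b, color_count ([set x; y] |: D) (recolor c [set x; y] g) u b
    <= (degree u)./2.
Proof.
move=> maj; rewrite !inE -!ltnNge => gx gy u b.
apply: (leq_trans (color_count_recolor _ _ _ _ _ _)).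
case: (boolP (_ && _)) => [|_]; last by rewrite addn0.
by rewrite !inE addn1 => /andP [/orP [/eqP -> | /eqP ->] /eqP ->].
Qed.

End PartialColoring.

(* [idx] is the search order, [par u] the smallest neighbor of [u], [sinks] the
   set Z. Every vertex [u] outside [sinks] except [root] has a signature edge
   [{u, sig u}]; these edges are colored in the order [rk]. For [root], [par] is
   merely some neighbor. *)
Record skeleton (G : sgraph) := Skeleton {
  idx : G -> nat;
  rk : G -> nat;
  par : G -> G;
  sig : G -> G;
  root : G;
  second : G;
  sinks : {set G};
  idx_inj : injective idx;
  rk_inj : injective rk;
  par_adj : forall u, adj u (par u);
  par_min : forall u v, adj u v -> idx (par u) <= idx v;
  par_lt : forall u, u != root -> idx (par u) < idx u;
  root_min : forall u, idx root <= idx u;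
  sink_max : forall z v, z \in sinks -> adj z v -> idx v < idx z;
  sig_adj : forall u, u \notin sinks -> u != root -> adj u (sig u);
  sig_par : forall u, u \notin sinks -> u != root -> sig u != par u;
  sig_root : forall u, u \notin sinks -> u != root -> sig u != root;
  sig_rk : forall u, u \notin sinks -> u != root ->
    sig u \notin sinks -> rk u < rk (sig u);
  sig_sink : forall u, u \notin sinks -> u != root ->
    sig u \in sinks -> par (sig u) != u;
  sink_private : forall z, z \in sinks -> exists x,
    [/\ x \notin sinks, x != root, sig x = z &
      forall z', z' \in sinks -> adj x z' -> par z' != x -> z' = z];
  sink_children : forall v, v != root ->
    #|[set z in sinks | par z == v]| + 2 <= degree v;
  sink_children_root : #|[set z in sinks | par z == root]| <= 1;
  sink_children_second : #|[set z in sinks | par z == second]| <= 1;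
  root_second : adj root second;
  second_nsink : second \notin sinks
}.

(** * The coloring attached to a skeleton *)

Section Coloring.

Variables (G : sgraph) (S : skeleton G) (s : nat).
Hypothesis deg2 : forall u : G, 2 <= degree u.
Hypothesis deg_le : forall u : G, degree u <= s ^ 2.

Local Notation Z := (sinks S).
Local Notation r := (root S).
Local Notation a := (second S).
Local Notation p := (par S).
Local Notation h := (sig S).
Local Notation idx := (idx S).
Local Notation rk := (rk S).
Local Notation C := 'I_(s.+3).

Implicit Types (D : {set {set G}}) (E : {set G}) (c : {set G} -> C).

Let active : {set G} := [set u | (u \notin Z) && (u != r)].

Lemma s_gt1 : 1 < s.
Proof. by have := leq_trans (deg2 r) (deg_le r); case: s => [|[|]]. Qed.

Lemma adj_neq (u v : G) : adj u v -> u != v.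
Proof. by apply: contraTneq => ->; rewrite adj_irrefl. Qed.

Lemma sink_nbr z v : z \in Z -> adj z v -> v \notin Z.
Proof.
move=> zZ zv; apply/negP => vZ; have := sink_max zZ zv.
by have := sink_max vZ (etrans (adj_sym _ _) zv); lia.
Qed.

Lemma root_nsink : r \notin Z.
Proof.
apply/negP => rZ; have := sink_max rZ (root_second S).
by have := root_min S a; lia.
Qed.

Lemma second_neq_root : a != r.
Proof. by rewrite eq_sym adj_neq ?root_second. Qed.

Lemma second_act : a \in active.
Proof. by rewrite inE second_nsink second_neq_root. Qed.

Lemma par_nsink u : u != r -> p u \notin Z.
Proof.
move=> ur; apply/negP => pZ; have := sink_max pZ (etrans (adj_sym _ _) (par_adj S u)).
by have := par_lt ur; lia.
Qed.

Lemma sink_neq_root z : z \in Z -> z != r.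
Proof. by apply: contraTneq => ->; exact: root_nsink. Qed.

(** * Star edges, ordinary edges and signature edges *)

Definition splitter v := [set z in Z | p z == v].

(** For each parent [v], the first [(degree v)./2] of its sink children in enumeration order. The
    second star color thus reaches a sink child of [v] only when the first one is exhausted at
    [v]. *)
Definition sinks1 : {set G} :=
  [set z in Z | index z (enum (splitter (p z))) < (degree (p z))./2].
Definition stars1 : {set {set G}} := [set [set p z; z] | z in sinks1].
Definition stars2 : {set {set G}} :=
  [set r; a] |: [set [set p z; z] | z in Z :\: sinks1].
Definition stars := stars1 :|: stars2.
Definition ordinary := [set E : {set G} | is_edge E] :\: stars.
Definition signature := [set [set u; h u] | u in active].
(* The edges colored first, in any order. *)
Definition base := ordinary :\: signature.

Lemma starsP E :
  reflect (E = [set r; a] \/ exists2 z, z \in Z & E = [set p z; z]) (E \in stars).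
Proof.
apply: (iffP idP).
  rewrite !inE => /or3P [/imsetP [z] | /eqP -> | /imsetP [z]]; last 2 [by left].
    by rewrite inE => /andP [zZ _] ->; right; exists z.
  by rewrite inE => /andP [_ zZ] ->; right; exists z.
case=> [-> | [z zZ ->]]; first by rewrite !inE eqxx orbT.
case: (boolP (z \in sinks1)) => z1.
  by rewrite inE; apply/orP; left; apply: imset_f.
by rewrite inE; apply/orP; right; rewrite inE; apply/orP; right; apply: imset_f; rewrite inE z1.
Qed.

Lemma mem_ordinary u v : adj u v -> ([set u; v] \in ordinary) = ([set u; v] \notin stars).
Proof. by move=> uv; rewrite inE [X in _ && X]inE is_edge_adj // andbT. Qed.

Lemma sig_nstar u : u \in active -> [set u; h u] \notin stars.
Proof.
rewrite inE => /andP [uZ ur]; apply/starsP => -[/set2_inj [[ur' _] | [_ hr]] | [z zZ /set2_inj [[up hz] | [uz _]]]].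
- by rewrite ur' eqxx in ur.
- by have := sig_root uZ ur; rewrite hr eqxx.
- by have := @sig_sink _ S u uZ ur; rewrite hz zZ -up eqxx => /(_ isT).
- by rewrite uz zZ in uZ.
Qed.

Lemma sig_ordinary u : u \in active -> [set u; h u] \in ordinary.
Proof.
move=> ua; rewrite mem_ordinary ?sig_nstar //.
by move: ua; rewrite inE => /andP [? ?]; apply: sig_adj.
Qed.

(** The vertex [a] is excepted because its edge to its parent [r] is a star edge. A crossed
    coincidence [w = p z], [z = p w] contradicts the descent of [idx] along [p]. *)
Lemma tree_nstar w : w \in active -> w != a -> [set p w; w] \notin stars.
Proof.
rewrite inE => /andP [wZ wr] wa; apply/starsP => -[/set2_inj [[_ E] | [_ E]] | [z zZ /set2_inj [[_ E] | [E wp]]]].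
- by rewrite E eqxx in wa.
- by rewrite E eqxx in wr.
- by rewrite E zZ in wZ.
- by have := par_lt wr; have := par_lt (sink_neq_root zZ); rewrite E -wp; lia.
Qed.

Lemma tree_star z : z \in Z -> [set p z; z] \in stars.
Proof. by move=> zZ; apply/starsP; right; exists z. Qed.

(* Every vertex has an edge outside [base]: its signature edge or its star. *)
Definition reserve u := if u == r then a else if u \in Z then p u else h u.

Lemma reserve_adj u : adj u (reserve u).
Proof.
rewrite /reserve; case: eqP => [-> | /eqP ur]; first exact: root_second.
by case: (boolP (u \in Z)) => uZ; rewrite ?par_adj // sig_adj.
Qed.

Lemma reserve_nbase u : [set u; reserve u] \notin base.
Proof.
rewrite inE [X in _ && X]inE /reserve; case: eqP => [-> | /eqP ur].
  have -> : [set r; a] \in stars by apply/starsP; left.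
  by rewrite andbF.
case: (boolP (u \in Z)) => uZ.
  by rewrite setUC tree_star // andbF.
by rewrite [X in ~~ X && _]imset_f // inE uZ.
Qed.

(** * Greedy coloring of the base edges *)

Definition child_count (D : {set {set G}}) (c : {set G} -> C) v (g : C) : nat :=
  #|[set w | [&& w != r, p w == v & [set v; w] \in D] && (c [set v; w] == g)]|.

(** The bound is [s.-1] rather than [s] because the signature edge of [v] may later add one more
    child edge of the same color. *)
Definition good_base D c :=
  (forall u g, color_count D c u g <= (degree u)./2) /\
  (forall v g, child_count D c v g <= s.-1).

Lemma child_count_recolor D c E g v b :
  child_count (E |: D) (recolor c E g) v b
    <= child_count D c v b + ((b == g) && [exists w, [&& w != r, p w == v & [set v; w] == E]]).
Proof.
pose X := [set w | [&& w != r, p w == v & [set v; w] == E] && (b == g)].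
apply: (@leq_trans #|[set w | [&& w != r, p w == v & [set v; w] \in D] && (c [set v; w] == b)]
   :|: X|).
  apply/subset_leq_card/subsetP => w; rewrite !inE /recolor.
  case: (w != r) => //=; case: (p w == v) => //=.
  by case: eqVneq => [_ | _]; rewrite /= ?orbF // eq_sym => ->; rewrite orbT.
rewrite cardsU; apply: (leq_trans (leq_subr _ _)); rewrite leq_add2l.
case: (boolP (_ && _)) => H.
  rewrite -ltnS ltnNge; apply/negP => /card_gt1P [w [y [+ + wy]]].
  rewrite !inE => /andP [/and3P [_ _ /eqP <-] _] /andP [/and3P [_ _ /eqP /set2_inj [[_ yw]|[vw yv]]] _].
    by rewrite yw eqxx in wy.
  by rewrite yv vw eqxx in wy.
rewrite leqn0 cards_eq0; apply/eqP/setP => w; rewrite !inE.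
apply/negP => /andP [EE bg]; case/negP: H; rewrite bg.
by apply/existsP; exists w.
Qed.

Lemma base_step D c x y :
  D \subset base -> [set x; y] \in base -> [set x; y] \notin D ->
  adj x y -> idx x < idx y -> good_base D c -> exists c', good_base ([set x; y] |: D) c'.
Proof.
move=> Db Eb ED xy ltxy [maj cls].
have ryx : y != reserve x by apply: contraTneq Eb => ->; apply: reserve_nbase.
have rxy : x != reserve y.
  by apply: contraTneq Eb => ->; rewrite setUC; apply: reserve_nbase.
have rD u : [set u; reserve u] \notin D.
  by apply/negP => /(subsetP Db); apply/negP/reserve_nbase.
have yx : adj y x by rewrite adj_sym.
(* At either end the reserved edge is a second uncolored one. *)
have satx := card_saturated1 c xy (reserve_adj x) ryx ED (rD x).
have saty : #|saturated D c y| <= 1.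
  by apply: (card_saturated1 c yx (reserve_adj y) rxy _ (rD y)); rewrite setUC.
pose F := [set g | s.-1 <= child_count D c x g].
(* (s + 1)(s - 1) > s^2 - 2, which bounds the number of children of x. *)
have cF : #|F| <= s.
  have := card_sup_mul (child_count D c x) s.-1; rewrite -/F.
  rewrite (card_partition_color (fun w => [&& w != r, p w == x & [set x; w] \in D])
    (fun w => c [set x; w])).
  set X := [set w | _] => le.
  have XN : X \subset [set w | adj x w].
    by apply/subsetP => w; rewrite !inE => /and3P [_ /eqP <- _]; rewrite adj_sym par_adj.
  have yX : y \notin X by rewrite inE (negPf ED) !andbF.
  (* A second neighbor of [x] outside [X]: [a] at the root, whose [par] is arbitrary, and the parent
     of [x] otherwise. *)
  have dX : #|X| + 2 <= degree x.
    case: (eqVneq x r) => xr.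
      apply: (degree_minus2 xy (reserve_adj x) ryx yX _ XN).
      by rewrite inE (negPf (rD x)) !andbF.
    apply: (degree_minus2 xy (par_adj S x) _ yX _ XN).
      by apply: contraTneq ltxy => ->; rewrite -leqNgt ltnW // par_lt.
    rewrite inE; apply/negP => /and3P [pr /eqP pp _].
    by have := par_lt pr; rewrite pp ltnNge (ltnW (par_lt xr)).
  by move: le (leq_trans dX (deg_le x)) s_gt1; clear; nia.
(* At most 1 + 1 + s forbidden colors out of s + 3. *)
have [|g [gx gy gF]] := @exists_notin3 _ (saturated D c x) (saturated D c y) F.
  by rewrite card_ord; lia.
exists (recolor c [set x; y] g); split; first exact: color_count_recolor_sat.
move=> v b; apply: (leq_trans (child_count_recolor _ _ _ _ _ _)).
case: (boolP (_ && _)) => [|_]; last by rewrite addn0.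
(* Only the lower end can gain a child edge, as parents precede their children in [idx]. *)
case/andP => /eqP -> /existsP [w /and3P [wr /eqP pw /eqP /set2_inj [[vx _] | [vy wx]]]].
  by move: gF; rewrite vx inE -ltnNge addn1.
by have := par_lt wr; rewrite pw vy wx ltnNge (ltnW ltxy).
Qed.

Lemma base_coloring : exists c, good_base base c.
Proof.
suff H n D : #|D| <= n -> D \subset base -> exists c, good_base D c by apply: (H _ base).
elim: n D => [|n IH] D; last first.
  case: (set_0Vmem D) => [-> _ | [E ED] cD Db]; first by apply: IH; rewrite ?cards0.
  have := cardsD1 E D; rewrite ED => cDE.
  have [|c gc] := IH (D :\ E) _ (subset_trans (subD1set _ _) Db); first by lia.
  have Eb := subsetP Db _ ED.
  have step u v : adj u v -> idx u < idx v -> E = [set u; v] ->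
      exists c', good_base (E |: (D :\ E)) c'.
    move=> uv lt EE; move: gc Eb Db; rewrite EE => gc Eb Db.
    apply: (base_step _ Eb _ uv lt gc); last by rewrite !inE eqxx.
    exact: subset_trans (subD1set _ _) Db.
  move: Eb; rewrite inE => /andP [_]; rewrite inE => /andP [_]; rewrite inE.
  case/existsP => x /existsP [y /andP [xy /eqP EE]]; rewrite -(setD1K ED).
  case: (ltngtP (idx x) (idx y)) => [lt | lt | /(@idx_inj _ S) xy'].
  - exact: step xy lt EE.
  - by apply: step _ lt _; rewrite 1?adj_sym // setUC.
  - by move: xy; rewrite xy' adj_irrefl.
rewrite leqn0 cards_eq0 => /eqP -> _; exists (fun=> ord0); split=> u g.
  rewrite (_ : color_count _ _ _ _ = 0) //.
  by apply/eqP; rewrite cards_eq0; apply/eqP/setP => v; rewrite !inE andbF.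
rewrite (_ : child_count _ _ _ _ = 0) //.
by apply/eqP; rewrite cards_eq0; apply/eqP/setP => v; rewrite !inE !andbF.
Qed.

(** * Coloring of the signature edges in the order [rk] *)

(** This is where acyclicity enters: the signature edge of [u] leads to a sink or to a vertex of
    larger rank, so coloring it affects neither earlier active vertices nor the root. *)
Lemma sig_notin u w : u \in active -> (w \in active -> rk w < rk u) -> w \notin Z ->
  w \notin [set u; h u].
Proof.
move=> ua wlt wZ; rewrite !inE negb_or; apply/andP.
have [ur uZ] : u != r /\ u \notin Z by move: ua; rewrite inE => /andP [].
split; apply/negP => /eqP E.
  by have := wlt; rewrite E ua ltnn => /(_ isT).
have wr : w != r by rewrite E sig_root.
have hZ : h u \notin Z by rewrite -E.
have := sig_rk uZ ur hZ; have := wlt; rewrite -E inE wZ wr => /(_ isT); lia.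
Qed.

Lemma sig_edge_inj : {in active &, injective (fun u => [set u; h u])}.
Proof.
move=> u w ua wa /= E; have /= := @sig_notin u w ua; have := @sig_notin w u wa.
rewrite -E [in X in _ -> X]E !inE !eqxx /=.
move: (ua) (wa); rewrite !inE => /andP [-> _] /andP [-> _].
case: (ltngtP (rk u) (rk w)) => [_ | _ | /(@rk_inj _ S) //].
  by move=> /(_ (fun=> isT) isT).
by move=> _ /(_ (fun=> isT) isT).
Qed.

Definition upto k := base :|: [set [set u; h u] | u in [set u in active | rk u < k]].

Lemma upto_ordinary k : upto k \subset ordinary.
Proof.
apply/subsetP => E; rewrite inE => /orP [|/imsetP [u]].
  by rewrite inE => /andP [].
by rewrite inE => /andP [ua _] ->; apply: sig_ordinary.
Qed.

Lemma sig_upto u k : u \in active -> ([set u; h u] \in upto k) = (rk u < k).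
Proof.
move=> ua; rewrite inE [X in X || _]inE [X in ~~ X]imset_f //=.
apply/imsetP/idP => [[w] | lt]; last by exists u; rewrite // inE ua.
by rewrite inE => /andP [wa lt] /sig_edge_inj -> .
Qed.

(** The signature edge of [u] is the last ordinary edge colored at [u], since those of later
    vertices avoid [u] by [sig_notin]. *)
Lemma ordinary_upto u E : u \in active -> u \in E -> E \in ordinary ->
  E != [set u; h u] -> E \in upto (rk u).
Proof.
move=> ua uE Eo nE; rewrite inE; apply/orP.
case: (boolP (E \in signature)) => [/imsetP [w wa EE] | Es]; last by left; rewrite inE Es.
right; apply/imsetP; exists w => //; rewrite inE wa /=.
rewrite ltnNge; apply/negP => le; move: uE; rewrite EE; apply/negP.
have [uw | uw] := eqVneq u w; first by rewrite EE uw eqxx in nE.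
apply: sig_notin => //; last by move: ua; rewrite inE => /andP [].
move=> _; rewrite ltn_neqAle le andbT.
by apply: contra_neq uw => /(@rk_inj _ S).
Qed.

Lemma color_count_off D c E g w b :
  w \notin E -> color_count D (recolor c E g) w b = color_count D c w b.
Proof.
move=> wE; apply: eq_card => v; rewrite !inE /recolor.
case: (eqVneq [set w; v] E) => // EE.
by rewrite -EE !inE eqxx in wE.
Qed.

Lemma child_count_off D c E g v b :
  E \notin D -> child_count D (recolor c E g) v b = child_count D c v b.
Proof.
move=> ED; apply: eq_card => w; rewrite !inE /recolor.
case: (eqVneq [set v; w] E) => // ->.
by rewrite (negPf ED) !andbF.
Qed.

(* The vertices whose color multiset [u] must avoid. As [{r, a}] is recognized by
   its color, [a] only has to be distinguished from [r]. *)
Definition rivals c u : {set G} :=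
  if u == a then [set r] else
  [set w in active | [&& w != a, rk w < rk u, p w == p u
                    & c [set p w; w] == c [set p u; u]]].

(** The third clause may count over all of [ordinary]: at [u] with [rk u < k] and at its rivals, no
    ordinary edge remains to be colored. *)
Definition good k c :=
  [/\ forall u g, color_count (upto k) c u g <= (degree u)./2,
      forall v g, child_count base c v g <= s.-1 &
      forall u w, u \in active -> rk u < k -> w \in rivals c u ->
        exists g, color_count ordinary c u g != color_count ordinary c w g].

(** A child never has its parent as [h], so the only signature edge from [v] to a child can be the
    one owned by [v]. *)
Lemma child_count_ordinary c v g :
  child_count ordinary c v g <= (child_count base c v g).+1.
Proof.
pose X := [set w | [&& w != r, p w == v & [set v; w] \in base] && (c [set v; w] == g)].
apply: (@leq_trans #|h v |: X|); last by rewrite cardsU1; case: (_ \notin _).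
apply/subset_leq_card/subsetP => w; rewrite inE.
case/andP => /and3P [wr /eqP pw wo] cw; rewrite in_setU1 inE wr pw eqxx cw andbT /=.
case: (boolP ([set v; w] \in signature)) => [|sn]; last by rewrite [X in _ || X]inE sn wo orbT.
case/imsetP => u; rewrite inE => /andP [uZ ur] /set2_inj [[-> ->] | [vu wu]].
  by rewrite eqxx.
by have := sig_par uZ ur; rewrite -vu -pw wu eqxx.
Qed.

(** For [u] other than [a], the rivals and [u] itself are children of [p u] joined to it by ordinary
    edges of one color, so they number at most [s]. *)
Lemma card_rivals k c u : good k c -> u \in active -> #|rivals c u| <= s.-1.
Proof.
case=> _ cls _ ua; rewrite /rivals; case: eqVneq => [_ | nua].
  by rewrite cards1; have := s_gt1; lia.
set W := [set w in active | _].
have uW : u \notin W by rewrite !inE ltnn !andbF.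
have : #|u |: W| <= s.
  have := child_count_ordinary c (p u) (c [set p u; u]); have := cls (p u) (c [set p u; u]).
  have := s_gt1 => s1 le1 le2; suff le3 : #|u |: W| <= child_count ordinary c (p u) (c [set p u; u]) by lia.
  apply/subset_leq_card/subsetP => w wW.
  have [wa [nwa pw cw]] : w \in active /\ [/\ w != a, p w = p u & c [set p w; w] = c [set p u; u]].
    move: wW; rewrite 2!inE => /orP [/eqP -> // | ].
    by rewrite inE => /and5P [-> -> _ /eqP -> /eqP ->].
  have := tree_nstar wa nwa; rewrite -mem_ordinary 1?adj_sym ?par_adj // pw => wo.
  by rewrite inE pw eqxx wo -cw pw eqxx; move: wa; rewrite inE => /andP [_ ->].
by rewrite cardsU1 uW; lia.
Qed.

Lemma upto_succ u : u \in active -> upto (rk u).+1 = [set u; h u] |: upto (rk u).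
Proof.
move=> ua; apply/setP => E; rewrite in_setU1; apply/idP/orP => [|[/eqP -> | ]].
- rewrite inE => /orP [Eb | /imsetP [w]]; first by right; rewrite inE Eb.
  rewrite inE ltnS leq_eqVlt => /andP [wa /orP [/eqP /(@rk_inj _ S) -> -> | lt ->]].
    by left.
  by right; rewrite sig_upto.
- by rewrite sig_upto.
- rewrite !in_setU => /orP [-> // | /imsetP [w]]; rewrite inE => /andP [wa lt] ->.
  by apply/orP; right; apply: imset_f; rewrite inE wa ltnW.
Qed.

Lemma rivals_rk c u w : u \in active -> w \in rivals c u ->
  w \notin Z /\ (w \in active -> rk w < rk u).
Proof.
rewrite /rivals => ua; case: ifP => _; last first.
  by rewrite inE => /andP [+ /and4P [_ -> _ _]]; rewrite inE => /andP [].
by rewrite inE => /eqP ->; rewrite root_nsink inE eqxx andbF.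
Qed.

Lemma color_count_sig c u b g : u \in active ->
  color_count ordinary (recolor c [set u; h u] g) u b
    = color_count (upto (rk u)) c u b + (b == g).
Proof.
move=> ua; have Enot : [set u; h u] \notin upto (rk u) by rewrite sig_upto // ltnn.
rewrite /color_count (cardsD1 (h u)) inE sig_ordinary // /recolor eqxx (eq_sym g) addnC.
have -> : adj u (h u) by move: ua; rewrite inE => /andP [? ?]; apply: sig_adj.
congr (_ + _); apply: eq_card => v; rewrite in_setD1 [X in _ && X]inE [RHS]inE.
have [-> | vh] := eqVneq v (h u); first by rewrite (negPf Enot) !andbF.
have nE : [set u; v] != [set u; h u].
  by apply/eqP => /set2_inj [[_ E] | [E1 E2]]; rewrite ?E ?E2 -?E1 ?eqxx // in vh.
rewrite (negPf nE) /=; congr (_ && _); congr (_ && _).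
apply/idP/idP => [vo | /(subsetP (upto_ordinary _)) //].
by apply: ordinary_upto; rewrite // !inE eqxx.
Qed.

Lemma signature_step c u : good (rk u) c -> u \in active -> exists c', good (rk u).+1 c'.
Proof.
move=> gc ua; have cR := card_rivals gc ua; have [maj cls dist] := gc.
have [uZ ur] : u \notin Z /\ u != r by move: ua; rewrite inE => /andP [].
have Enot : [set u; h u] \notin upto (rk u) by rewrite sig_upto // ltnn.
have uh := sig_adj uZ ur.
have sat_u := card_saturated2 c (deg2 u) uh Enot.
(* The second uncolored edge at [h u] is its star edge if [h u] is a sink, and its own signature
   edge otherwise. *)
have sat_h : #|saturated (upto (rk u)) c (h u)| <= 1.
  have hr := sig_root uZ ur.
  have hu : adj (h u) u by rewrite adj_sym.
  have Enot' : [set h u; u] \notin upto (rk u) by rewrite setUC.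
  case: (boolP (h u \in Z)) => hZ.
    apply: (card_saturated1 c hu (par_adj S (h u)) _ Enot').
      by rewrite eq_sym sig_sink.
    apply/negP => /(subsetP (upto_ordinary _)); rewrite mem_ordinary ?par_adj //.
    by rewrite setUC tree_star.
  have ha : h u \in active by rewrite inE hZ hr.
  apply: (card_saturated1 c hu (sig_adj hZ hr) _ Enot').
    apply/negP => /eqP uhh; have := sig_rk uZ ur hZ.
    have hhZ : h (h u) \notin Z by rewrite -uhh.
    by have := sig_rk hZ hr hhZ; rewrite -uhh ltnNge (ltnW (sig_rk uZ ur hZ)).
  by rewrite sig_upto // -leqNgt ltnW // sig_rk.
(* With [coll w g], the color [g] on the edge would give [u] the same multiset as [w]. Each [w]
   excludes at most one [g] in this way. *)
pose coll w g := [forall b, color_count ordinary c w b == color_count (upto (rk u)) c u b + (b == g)].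
pose B := [set g | [exists w in rivals c u, coll w g]].
have cB : #|B| <= s.-1.
  apply: leq_trans cR; pose f w := odflt ord0 [pick g | coll w g].
  apply: leq_trans (leq_imset_card f _); apply/subset_leq_card/subsetP => g.
  rewrite inE => /existsP [w /andP [wR cw]]; apply/imsetP; exists w => //.
  rewrite /f; case: pickP => [g' cw' | /(_ g)]; last by rewrite cw.
  have /eqP := forallP cw g; have /eqP := forallP cw' g; rewrite eqxx => -> /=.
  by move/addnI; case: eqVneq.
(* At most 2 + 1 + (s - 1) forbidden colors out of s + 3. *)
have [|g [gu gh gB]] := @exists_notin3 _ (saturated (upto (rk u)) c u)
    (saturated (upto (rk u)) c (h u)) B.
  by rewrite card_ord; have := s_gt1; lia.
have Enb : [set u; h u] \notin base.
  by apply: contra Enot => Eb; rewrite inE Eb.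
pose c' := recolor c [set u; h u] g.
have rkle w : w \in active -> rk w < (rk u).+1 -> w != u -> rk w < rk u.
  move=> wa; rewrite ltnS leq_eqVlt => /orP [/eqP /(@rk_inj _ S) -> | -> //].
  by rewrite eqxx.
have c'col w : w \in active -> w \notin [set u; h u] -> c' [set p w; w] = c [set p w; w].
  by move=> _ wE; rewrite /c' /recolor; case: eqP => // E; rewrite -E !inE eqxx orbT in wE.
have c'u : c' [set p u; u] = c [set p u; u].
  rewrite /c' /recolor; case: eqP => // /set2_inj [[pu uhu] | [phu _]].
    by have := par_lt ur; rewrite pu ltnn.
  by have := sig_par uZ ur; rewrite phu eqxx.
(* Recoloring creates no new rivals for vertices of rank at most [rk u], because the tree edges
   compared keep their colors. *)
have riv w x : w \in active -> rk w < (rk u).+1 -> x \in rivals c' w ->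
    x \in rivals c w /\ x \notin [set u; h u].
  move=> wa lt xR; have [xZ xw] := rivals_rk wa xR.
  have xE : x \notin [set u; h u].
    by apply: sig_notin => // xa; apply: leq_trans (xw xa) lt.
  split=> //; move: xR; rewrite /rivals; case: ifP => // _.
  rewrite [X in is_true X -> _]inE [X in _ -> is_true X]inE.
  case/andP => xa /and4P [nxa ltx pxw]; rewrite xa nxa ltx pxw c'col //=.
  have [-> | wu] := eqVneq w u; first by rewrite c'u.
  rewrite c'col //; apply: sig_notin => //; last by move: wa; rewrite inE => /andP [].
  by move=> _; apply: rkle.
exists c'; rewrite /good upto_succ //; split.
- exact: color_count_recolor_sat.
- by move=> v b; rewrite child_count_off.
move=> w x wa lt xR; have [xRc xE] := riv w x wa lt xR.
have [wu | wu] := eqVneq w u; last first.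
  have ltw := rkle w wa lt wu; have [b nb] := dist w x wa ltw xRc.
  exists b; rewrite !color_count_off //; apply: sig_notin => //.
  by move: wa; rewrite inE => /andP [].
move: gB; rewrite inE => /existsPn /(_ x); rewrite -wu xRc /= => /forallPn [b nb].
exists b; rewrite [X in _ != X]color_count_off // eq_sym; apply: contra nb => /eqP ->.
by rewrite -(color_count_sig c b g ua) wu.
Qed.

Lemma exists_good k : exists c, good k c.
Proof.
elim: k => [|k [c gc]].
  have [c [maj cls]] := base_coloring; exists c; split=> // u g.
  apply: leq_trans (maj u g); apply/subset_leq_card/subsetP => v.
  rewrite 2!inE => /andP [/andP [uv uvE] cE]; rewrite inE uv cE andbT /=.
  move: uvE; rewrite inE => /orP [|/imsetP [w]]; first by rewrite inE.
  by rewrite inE => /andP [_].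
(* Ranks may have gaps; a [k] that is the rank of no active vertex changes nothing. *)
case: (boolP [exists u in active, rk u == k]) => [/existsP [u /andP [ua /eqP uk]] | nu].
  by rewrite -uk in gc *; apply: signature_step gc ua.
have neq u : u \in active -> (rk u < k.+1) = (rk u < k).
  move=> ua; rewrite ltnS leq_eqVlt; case: eqP => // uk.
  by case/existsP: nu; exists u; rewrite ua uk eqxx.
have upE : upto k.+1 = upto k.
  rewrite /upto (_ : [set u in active | rk u < k.+1] = [set u in active | rk u < k]) //.
  by apply/setP => u; rewrite inE [RHS]inE; case: (boolP (u \in active)) => // /neq.
by case: gc => maj cls dist; exists c; split; rewrite ?upE // => u w ua; rewrite neq //; apply: dist.
Qed.

(** Of two siblings with tree edges of equal color, the one of larger rank had the other as a rival,
    which makes the separation symmetric. *)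
Lemma ordinary_coloring : exists c,
  [/\ forall u g, color_count ordinary c u g <= (degree u)./2,
      forall u w, u \in active -> w \in active -> u != w -> u != a -> w != a -> p u = p w ->
        c [set p u; u] = c [set p w; w] ->
        exists g, color_count ordinary c u g != color_count ordinary c w g &
      exists g, color_count ordinary c a g != color_count ordinary c r g].
Proof.
pose K := (\max_u rk u).+1; have [c [maj cls dist]] := exists_good K.
have rkK u : rk u < K by rewrite ltnS; apply: (@leq_bigmax _ (fun u => rk u)).
have upE : upto K = ordinary.
  apply/eqP; rewrite eqEsubset upto_ordinary; apply/subsetP => E Eo.
  rewrite inE; case: (boolP (E \in signature)) => [/imsetP [u ua ->] | Es].
    by apply/orP; right; apply: imset_f; rewrite inE ua rkK.
  by rewrite [X in X || _]inE Es Eo.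
exists c; rewrite upE in maj; split=> //; last first.
  by apply: (dist a r second_act (rkK a)); rewrite /rivals eqxx inE.
have H u w : u \in active -> w \in active -> u != a -> w != a -> p u = p w -> rk w < rk u ->
    c [set p u; u] = c [set p w; w] ->
    exists g, color_count ordinary c u g != color_count ordinary c w g.
  move=> ua wa nua nwa pp lt cc; apply: dist => //.
  by rewrite /rivals (negPf nua) inE wa nwa lt cc pp !eqxx.
move=> u w ua wa uw nua nwa pp cc; case: (ltngtP (rk u) (rk w)) => [lt | lt | /(@rk_inj _ S) E].
- by have [g] := H w u wa ua nwa nua (esym pp) lt (esym cc); exists g; rewrite eq_sym.
- exact: H.
- by rewrite E eqxx in uw.
Qed.

(** * The final coloring and its majority property *)

Section Final.

Variable c : {set G} -> C.
Hypothesis majo : forall u g, color_count ordinary c u g <= (degree u)./2.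
Hypothesis disto : forall u w, u \in active -> w \in active -> u != w -> u != a -> w != a ->
  p u = p w -> c [set p u; u] = c [set p w; w] ->
  exists g, color_count ordinary c u g != color_count ordinary c w g.
Hypothesis dista : exists g, color_count ordinary c a g != color_count ordinary c r g.

(** [inl true] is the first star color and [inl false] the second, which gives [2 + (s + 3)] colors
    in all. *)
Definition final E : (bool + C)%type :=
  if E \in stars1 then inl true else if E \in stars2 then inl false else inr (c E).

Definition final_count u (t : bool + C) : nat := #|[set v | adj u v && (final [set u; v] == t)]|.

Lemma final_inr E g : (final E == inr g) = (E \notin stars) && (c E == g).
Proof.
rewrite /final [E \in stars]inE; case: ifP => //= _; case: ifP => //= _.
Qed.

Lemma final_count_inr u g : final_count u (inr g) = color_count ordinary c u g.
Proof.
apply: eq_card => v; rewrite 2!inE; case: (boolP (adj u v)) => //= uv.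
by rewrite final_inr mem_ordinary.
Qed.

Lemma stars1P u v : [set u; v] \in stars1 ->
  (v \in sinks1 /\ u = p v) \/ (u \in sinks1 /\ v = p u).
Proof. by case/imsetP => z z1 /set2_inj [[-> ->] | [-> ->]]; [left|right]. Qed.

Lemma stars2P u v : [set u; v] \in stars2 ->
  [\/ [set u; v] = [set r; a], v \in Z :\: sinks1 /\ u = p v |
      u \in Z :\: sinks1 /\ v = p u].
Proof.
rewrite inE => /orP [|/imsetP [z z2 /set2_inj [[-> ->] | [-> ->]]]].
- by rewrite inE => /eqP; constructor 1.
- by constructor 2.
- by constructor 3.
Qed.

Lemma sinks1_sub z : z \in sinks1 -> z \in Z.
Proof. by rewrite inE => /andP []. Qed.

Lemma half_gt0 (u : G) : 0 < (degree u)./2.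
Proof. by have := deg2 u; lia. Qed.

Definition splitter1 v := [set z in splitter v | z \in sinks1].

Lemma card_splitter1 v : #|splitter1 v| = minn (degree v)./2 #|splitter v|.
Proof.
rewrite -card_index_lt; apply: eq_card => z; rewrite !inE.
by case: (boolP (z \in Z)) => //= _; case: eqP => //= ->.
Qed.

Lemma final_true E : (final E == inl true) = (E \in stars1).
Proof. by rewrite /final; case: ifP => // _; case: ifP. Qed.

Lemma final_false E : final E == inl false -> E \in stars2.
Proof. by rewrite /final; case: ifP => // _; case: ifP. Qed.

(** Neighbors of a sink are not sinks, so its only star edge goes to its parent. *)
Lemma final_count_sink b u : u \in Z -> final_count u (inl b) <= 1.
Proof.
move=> uZ; rewrite -(cards1 (p u)); apply/subset_leq_card/subsetP => v.
have nr : u != r by apply: sink_neq_root.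
have na : u != a by apply: contraTneq uZ => ->; exact: second_nsink.
rewrite [X in is_true X -> _]inE in_set1 => /andP [uv]; have vZ := sink_nbr uZ uv.
case: b => [|/final_false]; first rewrite final_true.
  by case/stars1P => [[/sinks1_sub v1] | [_ -> //]]; rewrite v1 in vZ.
case/stars2P => [/set2_inj [[E _] | [E _]] | [] | [_ -> //]].
- by rewrite E eqxx in nr.
- by rewrite E eqxx in na.
- by rewrite inE (negPf vZ) andbF.
Qed.

Lemma final_count_true u : u \notin Z -> final_count u (inl true) = #|splitter1 u|.
Proof.
move=> uZ; apply: eq_card => v; rewrite inE final_true.
apply/andP/idP => [[uv /stars1P [[v1 E] | [/sinks1_sub u1]]] | ].
- by rewrite !inE E eqxx (sinks1_sub v1) /=; move: v1; rewrite inE => /andP [].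
- by rewrite u1 in uZ.
- rewrite inE => /andP [+ v1]; rewrite inE => /andP [_ /eqP E].
  by rewrite -E adj_sym par_adj; split=> //; apply: imset_f.
Qed.

Lemma splitter1_sub v : splitter1 v \subset splitter v.
Proof. by apply/subsetP => z; rewrite inE => /andP []. Qed.

Lemma splitter_small v z : #|splitter v| <= 1 -> z \in Z -> p z = v -> z \in sinks1.
Proof.
move=> le zZ pz; suff : z \in splitter1 v by rewrite inE => /andP [].
rewrite (eqP (_ : splitter1 v == splitter v)); first by rewrite inE zZ pz eqxx.
by rewrite eqEcard splitter1_sub card_splitter1; have := half_gt0 v; lia.
Qed.

Lemma splitter_small_ends v : v \in [set r; a] -> #|splitter v| <= 1.
Proof.
by case/set2P => ->; [exact: sink_children_root | exact: sink_children_second].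
Qed.

Lemma ends_nsink v : v \in [set r; a] -> v \notin Z.
Proof. by case/set2P => ->; [exact: root_nsink | exact: second_nsink]. Qed.

Lemma final_count_true_ends v : v \in [set r; a] -> final_count v (inl true) <= 1.
Proof.
move=> vra; rewrite final_count_true ?ends_nsink //.
exact: leq_trans (subset_leq_card (splitter1_sub v)) (splitter_small_ends vra).
Qed.

(** At [r] and [a] only the edge between them counts, as a sink child there gets the first star
    color. Elsewhere at most [degree u - 2] sink children exist, and the first [(degree u)./2] do
    not count. *)
Lemma final_count_false u : u \notin Z -> final_count u (inl false) <= (degree u)./2.
Proof.
move=> uZ; case: (boolP (u \in [set r; a])) => ura.
  apply: leq_trans (half_gt0 u); rewrite -(cards1 (if u == r then a else r)).
  apply/subset_leq_card/subsetP => v; rewrite inE in_set1 => /andP [_ /final_false].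
  case/stars2P => [/set2_inj [[-> ->] | [-> ->]] | [+ E] | [+ _]].
  - by rewrite eqxx.
  - by rewrite (negPf second_neq_root).
  - by rewrite inE => /andP [v1 vZ]; case/negP: v1; apply: splitter_small (splitter_small_ends ura) vZ (esym E).
  - by rewrite inE (negPf uZ) andbF.
have ur : u != r by apply: contraNneq ura => ->; rewrite !inE eqxx.
have le : final_count u (inl false) <= #|splitter u :\: splitter1 u|.
  apply/subset_leq_card/subsetP => v; rewrite inE => /andP [_ /final_false].
  case/stars2P => [E | [+ E] | [+ _]].
  - by case/negP: ura; rewrite -E !inE eqxx.
  - by rewrite inE => /andP [v1 vZ]; rewrite inE [X in ~~ X]inE (negPf v1) andbF inE vZ E eqxx.
  - by rewrite inE (negPf uZ) andbF.
move: le; rewrite cardsDS ?splitter1_sub // card_splitter1.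
have : #|splitter u| + 2 <= degree u by exact: sink_children.
by clear; lia.
Qed.

Lemma final_majority u t : 2 * final_count u t <= degree u.
Proof.
suff : final_count u t <= (degree u)./2 by lia.
case: t => [b | g]; last by rewrite final_count_inr.
case: (boolP (u \in Z)) => uZ.
  exact: leq_trans (final_count_sink b uZ) (half_gt0 u).
case: b; last exact: final_count_false.
by rewrite final_count_true // card_splitter1 geq_minl.
Qed.

(** The first star color is exhausted at [v = p z], so [(degree v)./2 < degree v - 2] and hence
    [degree v >= 5]. This tells the edge from [[set r; a]]. *)
Lemma splitter1_gt1 z : z \in Z :\: sinks1 -> 1 < #|splitter1 (p z)|.
Proof.
rewrite inE => /andP [z1 zZ]; have lt : #|splitter1 (p z)| < #|splitter (p z)|.
  apply: proper_card; apply/properP; split; first exact: splitter1_sub.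
  by exists z; [rewrite inE zZ eqxx | rewrite inE (negPf z1) andbF].
have [pr | pr] := eqVneq (p z) r.
  have := splitter_small (sink_children_root S) zZ pr.
  by rewrite (negPf z1).
have : #|splitter (p z)| + 2 <= degree (p z) by exact: sink_children.
by move: lt; rewrite card_splitter1; clear; lia.
Qed.

Lemma final_stars E : (E \in stars) = if final E is inl _ then true else false.
Proof. by rewrite /final [E \in stars]inE; case: ifP => //= _; case: ifP. Qed.

Lemma final_nstar E : E \notin stars -> final E = inr (c E).
Proof. by move=> Es; apply/eqP; rewrite final_inr Es eqxx. Qed.

(** * Rigidity of the final coloring *)

Section Rigidity.

Variable phi : {perm G}.
Hypothesis phi_adj : forall u v, adj (phi u) (phi v) = adj u v.
Hypothesis phi_final : forall u v, adj u v ->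
  final [set phi u; phi v] = final [set u; v].

Lemma final_count_phi u t : final_count (phi u) t = final_count u t.
Proof.
rewrite /final_count -[RHS](card_imset _ (@perm_inj _ phi)); apply: eq_card => v.
apply/idP/imsetP => [| [w + ->]]; last first.
  by rewrite !inE phi_adj => /andP [uw]; rewrite phi_final // uw.
rewrite inE -(permKV phi v) phi_adj => /andP [uv E].
by exists ((phi^-1)%g v); rewrite // inE uv -phi_final.
Qed.

(** By its color the image of [[set r; a]] is this edge itself or a star edge whose parent end has
    two edges of the first star color, unlike [r] and [a]. The swap is excluded by [dista]. *)
Lemma phi_ends : phi r = r /\ phi a = a.
Proof.
have ra2 : final [set r; a] = inl false.
  rewrite /final; case: ifP => [/stars1P [[/sinks1_sub] | [/sinks1_sub]] | _].
  - by rewrite (negPf (second_nsink S)).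
  - by rewrite (negPf root_nsink).
  - by rewrite !inE eqxx.
have contra u v : v \in Z :\: sinks1 -> u \in [set r; a] -> phi u = p v -> False.
  move=> v2 ura E; have := splitter1_gt1 v2; rewrite -E.
  have vr : v != r by apply: sink_neq_root; move: v2; rewrite inE => /andP [].
  rewrite -final_count_true ?final_count_phi ?E ?par_nsink //.
  by have := final_count_true_ends ura; lia.
have /eqP/final_false := etrans (phi_final (root_second S)) ra2.
case/stars2P => [/set2_inj [[-> ->] // | [ra ar]] | [v2 E] | [v2 E]].
- have [g] := dista; rewrite -!final_count_inr -[in X in X != _]ra.
  by rewrite final_count_phi eqxx.
- by case: (contra r _ v2 _ E); rewrite !inE eqxx.
- by case: (contra a _ v2 _ E); rewrite !inE eqxx orbT.
Qed.

Lemma phi_nsink u : u \notin Z -> phi u = u.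
Proof.
have [phir phia] := phi_ends.
have [n] := ubnP (idx u); elim: n u => // n IH u ltn uZ.
have [-> // | ur] := eqVneq u r; have [-> // | ua] := eqVneq u a.
have uact : u \in active by rewrite inE uZ.
have pu : phi (p u) = p u.
  by apply: IH; [exact: leq_trans (par_lt ur) ltn | exact: par_nsink].
have yr : phi u != r by rewrite -phir (inj_eq perm_inj).
have ya : phi u != a by rewrite -phia (inj_eq perm_inj).
have py : adj (p u) (phi u) by rewrite -{1}pu phi_adj adj_sym par_adj.
(* [phi u] sees the fixed vertex [p u]; a smaller parent of [phi u] would be fixed as well, hence
   adjacent to [u]. *)
have pp : p (phi u) = p u.
  apply: (@idx_inj _ S); apply/eqP; rewrite eqn_leq par_min 1?adj_sym //=.
  rewrite leqNgt; apply/negP => lt.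
  have q : phi (p (phi u)) = p (phi u).
    apply: IH; last exact: par_nsink.
    exact: leq_trans (ltn_trans lt (par_lt ur)) ltn.
  have : adj u (p (phi u)) by rewrite -phi_adj q par_adj.
  by move/(@par_min _ S); rewrite leqNgt lt.
have fE : final [set p u; phi u] = final [set p u; u].
  by rewrite -{1}pu phi_final // adj_sym par_adj.
have us := tree_nstar uact ua.
have yZ : phi u \notin Z.
  apply/negP => yZ; have := tree_star yZ; rewrite pp final_stars fE -final_stars.
  by rewrite (negPf us).
have yact : phi u \in active by rewrite inE yZ.
apply/eqP; apply: contraT; rewrite eq_sym => uy.
have [] := disto uact yact uy ua ya (esym pp).
  by move: fE; rewrite pp final_nstar ?final_nstar // -?pp ?tree_nstar // => -[->].
by move=> g; rewrite -!final_count_inr final_count_phi eqxx.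
Qed.

(** The signature edge from the private vertex [x] to [z] is not mapped to a star edge, so [phi z]
    is a sink seen from the fixed [x] and not a child of [x]; only [z] qualifies. *)
Lemma phi_sink z : z \in Z -> phi z = z.
Proof.
move=> zZ; have [x [xZ xr hx priv]] := sink_private zZ.
have px := phi_nsink xZ; have xz : adj x z by rewrite -hx sig_adj.
have yZ : phi z \in Z.
  apply: contraT => yZ; have /perm_inj E := phi_nsink yZ.
  by rewrite E zZ in yZ.
apply: priv => //; first by rewrite -px phi_adj.
apply/eqP => py; have := tree_star yZ; rewrite py final_stars -{1}px phi_final //.
by rewrite -final_stars -hx (negPf (sig_nstar _)) // inE xZ.
Qed.

Lemma phi_id : phi = 1%g.
Proof.
apply/permP => u; rewrite perm1.
by case: (boolP (u \in Z)) => [/phi_sink | /phi_nsink].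
Qed.

End Rigidity.

End Final.

Lemma skeleton_colorable : md_colorable G (s + 5).
Proof.
have [c [majo disto dista]] := ordinary_coloring.
have -> : s + 5 = #|{: bool + C}| by rewrite card_sum card_bool card_ord; lia.
apply: (md_colorable_finType (f := final c)).
  exact: final_majority.
by move=> phi phi_adj phi_final; apply: (phi_id disto dista).
Qed.

End Coloring.

(** * A skeleton from a search order *)

Section Skeleton.

Variables (G : sgraph) (idx : G -> nat) (r a x0 : G).
Implicit Types (u v w x y z : G).
Hypothesis deg2 : forall u : G, 2 <= degree u.
Hypothesis idxI : injective idx.
Hypothesis r_min : forall u, idx r <= idx u.
Hypothesis ra : adj r a.
Hypothesis smaller_nbr : forall u, u != r -> exists2 v, adj u v & idx v < idx u.
Hypothesis succ_nbr : forall u v, adj u v -> idx u < idx v ->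
  exists2 y, adj u y & idx y = (idx u).+1.

Definition locmax u := [forall v, adj u v ==> (idx v < idx u)].
(** Above such a vertex there are only local maxima, so a signature edge going up must end in
    one. *)
Definition penultimate u :=
  ~~ locmax u && [forall v, adj u v && (idx u < idx v) ==> locmax v].

Hypothesis a_nmax : ~~ locmax a.
(* Follows from the maximality of the initial path: such a [z] only sees the path,
   whose last but one vertex is [x0]. *)
Hypothesis x0_uniq : forall z x, locmax z -> adj r z || adj a z -> adj z x ->
  penultimate x -> x = x0.

Lemma locmaxP u v : locmax u -> adj u v -> idx v < idx u.
Proof. by move=> /forallP /(_ v) /implyP; apply. Qed.

Lemma nlocmaxP u : ~~ locmax u -> exists2 v, adj u v & idx u < idx v.
Proof.
move=> /forallPn [v]; rewrite negb_imply -leqNgt => /andP [uv le].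
exists v => //; rewrite ltn_neqAle le andbT.
by apply: contraTneq uv => /idxI ->; rewrite adj_irrefl.
Qed.

Lemma locmax_nbr u v : locmax u -> adj u v -> ~~ locmax v.
Proof.
move=> mu uv; apply/negP => mv; have := locmaxP mu uv.
by rewrite ltnNge ltnW // locmaxP // adj_sym.
Qed.

Lemma other_nbr u v : exists2 w, adj u w & w != v.
Proof.
have := deg2 u; rewrite /degree => /card_gt1P [x [y [+ + xy]]]; rewrite !inE => ux uy.
by have [xv | xv] := eqVneq x v; [exists y; rewrite // -xv eq_sym | exists x].
Qed.

Definition min_nbr u : G :=
  [arg min_(v < odflt u [pick v | adj u v] | adj u v) idx v].

Lemma min_nbrP u : adj u (min_nbr u) /\ (forall v, adj u v -> idx (min_nbr u) <= idx v).
Proof.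
rewrite /min_nbr; case: arg_minnP => [|v uv vmin]; last by split.
by case: pickP => //= nou; have [w uw _] := other_nbr u u; rewrite nou in uw.
Qed.

Lemma min_nbr_adj u : adj u (min_nbr u).
Proof. by case: (min_nbrP u). Qed.

Lemma min_nbr_min u v : adj u v -> idx (min_nbr u) <= idx v.
Proof. by case: (min_nbrP u) => _; apply. Qed.

Lemma min_nbr_lt u : u != r -> idx (min_nbr u) < idx u.
Proof. by move=> /smaller_nbr [v uv]; apply: leq_ltn_trans; apply: min_nbr_min. Qed.

(* The successor of [u] can only see vertices up to [u], and it sees at least two. *)
Lemma succ_min_nbr u y : locmax y -> idx y = (idx u).+1 -> min_nbr y != u.
Proof.
move=> my yu; have [w yw wu] := other_nbr y u; apply/negP => /eqP E.
have := locmaxP my yw; rewrite yu ltnS leq_eqVlt => /orP [/eqP /idxI wu' | ].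
  by rewrite wu' eqxx in wu.
by rewrite ltnNge -E min_nbr_min.
Qed.

(* Excluding [min_nbr z = x] keeps signature edges apart from star edges. *)
Definition targets x := [set z | [&& adj x z, idx x < idx z & min_nbr z != x]].

Lemma targets_neq0 x : penultimate x -> exists z, z \in targets x.
Proof.
case/andP => /nlocmaxP [v xv lt] /forallP mx; have [y xy yx] := succ_nbr xv lt.
exists y; rewrite inE xy yx ltnSn succ_min_nbr //.
by apply: (implyP (mx y)); rewrite xy yx ltnSn.
Qed.

Lemma target_max x z : penultimate x -> z \in targets x -> locmax z.
Proof.
case/andP => _ /forallP mx; rewrite inE => /and3P [xz lt _].
by apply: (implyP (mx z)); rewrite xz lt.
Qed.

(** * Minimal hitting sets and the signature map *)

Definition hitting (Y : {set G}) :=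
  [forall x, penultimate x ==> [exists z in Y, z \in targets x]].

(** By minimality, removing [z] leaves some penultimate vertex unhit, and [z] is its only target in
    [Z]. *)
Lemma minimal_hitting : exists Z : {set G},
  (forall x, penultimate x -> exists2 z, z \in Z & z \in targets x) /\
  (forall z, z \in Z -> exists x, [/\ penultimate x, z \in targets x &
     forall z', z' \in Z -> z' \in targets x -> z' = z]).
Proof.
have [|Z /minsetP [hitZ minZ]] := @ex_minset _ hitting.
  exists setT; apply/forallP => x; apply/implyP => /targets_neq0 [z zx].
  by apply/existsP; exists z; rewrite inE.
have hit x : penultimate x -> exists2 z, z \in Z & z \in targets x.
  move=> px; have /existsP [z /andP [? ?]] := implyP (forallP hitZ x) px.
  by exists z.
exists Z; split=> // z zZ; have : ~~ hitting (Z :\ z).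
  apply/negP => /minZ /(_ (subD1set _ _)) E.
  by move: zZ; rewrite -E !inE eqxx.
case/forallPn => x; rewrite negb_imply => /andP [px /existsPn nx].
have uniq_z z' : z' \in Z -> z' \in targets x -> z' = z.
  move=> z'Z z'x; have := nx z'; rewrite in_setD1 z'Z z'x !andbT negbK.
  by move/eqP.
exists x; split=> //; have [z' z'Z z'x] := hit x px.
by rewrite -(uniq_z z').
Qed.

Lemma skeleton_exists : inhabited (skeleton G).
Proof.
have [Z [hit priv]] := minimal_hitting.
have Zmax z : z \in Z -> locmax z.
  by case/priv => x [px zx _]; apply: target_max zx.
(* Penultimate vertices go up to a sink, local maxima go down but not to the parent, and all others
   go up to a vertex that is no local maximum. The default [u] is never reached. *)
pose h u := if penultimate u then odflt u [pick z in Z | z \in targets u]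
  else if locmax u then odflt u [pick v | adj u v & v != min_nbr u]
  else odflt u [pick v | [&& adj u v, idx u < idx v & ~~ locmax v]].
have h_pen u : penultimate u -> h u \in Z /\ h u \in targets u.
  rewrite /h => pu; rewrite pu; case: pickP => [z /andP [] // | no].
  by have [z zZ zu] := hit u pu; have := no z; rewrite zZ zu.
have h_max u : locmax u -> adj u (h u) /\ h u != min_nbr u.
  move=> mu; rewrite /h /penultimate mu /=; case: pickP => [z /andP [] // | no].
  by have [z uz zu] := other_nbr u (min_nbr u); have := no z; rewrite uz zu.
have h_else u : ~~ penultimate u -> ~~ locmax u ->
    [/\ adj u (h u), idx u < idx (h u) & ~~ locmax (h u)].
  move=> pu mu; rewrite /h (negPf pu) (negPf mu).
  case: pickP => [z /and3P [] // | no].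
  move: pu; rewrite /penultimate mu => /forallPn [z]; rewrite negb_imply -andbA.
  by rewrite no.
have pen_nmax u : penultimate u -> ~~ locmax u by case/andP.
have a_pen : ~~ penultimate r.
  apply/negP => /andP [_ /forallP /(_ a)]; rewrite ra (negPf a_nmax) implybF.
  rewrite ltn_neqAle r_min andbT negbK => /eqP /idxI E.
  by move: ra; rewrite E adj_irrefl.
pose N := (\max_u idx u).+1.
have ltN u : idx u < N by rewrite ltnS; apply: (@leq_bigmax _ idx).
(* Local maxima come first: their signature edges descend to vertices that are not local maxima,
   whose own signature edges ascend. *)
pose rk u := if locmax u then idx u else N + idx u.
have rkI : injective rk.
  move=> u v; rewrite /rk; case: ifP => _; case: ifP => _ E; apply: idxI.
  - by [].
  - by have := ltN u; rewrite E ltnNge leq_addr.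
  - by have := ltN v; rewrite -E ltnNge leq_addr.
  - exact: addnI E.
have h_lt u : ~~ locmax u -> adj u (h u) /\ idx u < idx (h u).
  move=> mu; case: (boolP (penultimate u)) => pu; last by case: (h_else u pu mu).
  by have [_] := h_pen u pu; rewrite inE => /and3P [].
have lt_root u v : u != r -> idx u < idx v -> v != r /\ v != min_nbr u.
  move=> ur lt; split; apply/negP => /eqP E; move: lt; rewrite E ltnNge.
    by rewrite r_min.
  by rewrite ltnW // min_nbr_lt.
(* Two sinks with parent [v] would both have [x0] as private vertex. *)
have children v : v \in [set r; a] -> #|[set z in Z | min_nbr z == v]| <= 1.
  move=> vra; rewrite leqNgt; apply/negP => /card_gt1P [z [z' [+ + /negP]]].
  rewrite !inE => /andP [zZ /eqP pz] /andP [z'Z /eqP pz'] [].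
  have x0E y : y \in Z -> min_nbr y = v -> y \in targets x0 /\
      forall y', y' \in Z -> y' \in targets x0 -> y' = y.
    move=> yZ py; have [x [px yx yu]] := priv y yZ.
    have vy : adj v y by rewrite -py adj_sym min_nbr_adj.
    suff <- : x = x0 by [].
    apply: (x0_uniq (Zmax y yZ)) px.
      by move: vra vy => /set2P [-> | ->] ->; rewrite ?orbT.
    by rewrite adj_sym; move: yx; rewrite inE => /and3P [].
  have [zx _] := x0E z zZ pz; have [_ zu] := x0E z' z'Z pz'.
  by rewrite (zu z).
constructor; apply: (@Skeleton G idx rk min_nbr h r a Z idxI rkI min_nbr_adj
  min_nbr_min min_nbr_lt r_min) => //.
- by move=> z v /Zmax; apply: locmaxP.
- move=> u _ _; case: (boolP (locmax u)) => [/h_max [] // | /h_lt [] //].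
- move=> u _ ur; case: (boolP (locmax u)) => [/h_max [] // | /h_lt [_]].
  by case/(lt_root u _ ur).
- move=> u _ ur; case: (boolP (locmax u)) => [/h_max [uh] | /h_lt [_]].
    apply: contra => /eqP hr; apply/eqP/idxI/eqP; rewrite eqn_leq hr r_min.
    by rewrite min_nbr_min // -hr.
  by case/(lt_root u _ ur).
- move=> u uZ ur hZ; rewrite /rk; case: (boolP (locmax u)) => mu.
    have [uh _] := h_max u mu; rewrite (negPf (locmax_nbr mu uh)).
    exact: leq_trans (ltN u) (leq_addr _ _).
  case: (boolP (penultimate u)) => pu; first by case: (h_pen u pu) => hZ'; rewrite hZ' in hZ.
  by have [_ lt hm] := h_else u pu mu; rewrite (negPf hm) ltn_add2l.
- move=> u uZ ur hZ; case: (boolP (penultimate u)) => pu.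
    by have [_] := h_pen u pu; rewrite inE => /and3P [].
  have mh := Zmax _ hZ; case: (boolP (locmax u)) => mu.
    by have [uh _] := h_max u mu; rewrite (negPf (locmax_nbr mu uh)) in mh.
  by have [_ _ hm] := h_else u pu mu; rewrite mh in hm.
- move=> z zZ; have [x [px zx zu]] := priv z zZ; have [hZ hx] := h_pen x px.
  exists x; split.
  + by apply/negP => /Zmax; apply/negP/pen_nmax.
  + by apply: contraTneq px => ->.
  + exact: zu.
  + move=> z' z'Z xz' px'; apply: zu => //; rewrite inE xz' px' andbT /=.
    by apply: locmaxP (Zmax _ z'Z) _; rewrite adj_sym.
- move=> v vr; case: (set_0Vmem [set z in Z | min_nbr z == v]) => [-> | [z]].
    by rewrite cards0.
  rewrite inE => /andP [zZ /eqP pz].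
  have gt w : min_nbr w = v -> w \in Z -> idx v < idx w.
    by move=> <- wZ; apply: locmaxP (Zmax _ wZ) (min_nbr_adj w).
  have vz : adj v z by rewrite -pz adj_sym min_nbr_adj.
  have [y vy yv] := succ_nbr vz (gt z pz zZ).
  (* The parent of [v] and its successor [y] are two neighbors that are not sink children of [v]. *)
  apply: (degree_minus2 (min_nbr_adj v) vy).
  + by apply/negP => /eqP E; have := min_nbr_lt vr; rewrite E yv; lia.
  + rewrite inE; apply/negP => /andP [wZ /eqP pw].
    by have := gt _ pw wZ; rewrite ltnNge ltnW // min_nbr_lt.
  + rewrite inE; apply/negP => /andP [yZ]; apply/negP.
    exact: succ_min_nbr (Zmax _ yZ) yv.
  + by apply/subsetP => w; rewrite !inE => /andP [_ /eqP <-]; rewrite adj_sym min_nbr_adj.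
- by apply: children; rewrite !inE eqxx.
- by apply: children; rewrite !inE eqxx orbT.
- by apply/negP => /Zmax; apply/negP.
Qed.

End Skeleton.

(** * The search order *)

Section Order.

Variable G : sgraph.
Implicit Types (u v w x y z : G) (s t : seq G).
Hypothesis conn : connected G.
Hypothesis deg2 : forall u : G, 2 <= degree u.

(** Weaker than depth-first search: after a dead end, any unvisited vertex with a visited neighbor
    may follow. *)
Definition greedy x0 s :=
  [/\ uniq s,
      forall i, i.+1 < size s -> exists2 j, j <= i & adj (nth x0 s j) (nth x0 s i.+1) &
      forall i, i.+1 < size s -> adj (nth x0 s i) (nth x0 s i.+1) \/
        forall y, adj (nth x0 s i) y -> y \in take i.+1 s].

Lemma boundary_edge x s : x \notin s -> s != [::] ->
  exists u v, [/\ u \in s, v \notin s & adj u v].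
Proof.
case: s => // y s xs _; case: (boolP [exists u in y :: s, [exists v, (v \notin y :: s) && adj u v]]).
  by case/existsP => u /andP [us /existsP [v /andP [vs uv]]]; exists u, v.
move/existsPn => no; have cl : closed (@adj G) (mem (y :: s)).
  move=> u v uv; apply/idP/idP => [us | vs].
    apply: contraT => vs; have := no u; rewrite us => /existsPn /(_ v).
    by rewrite vs uv.
  apply: contraT => us; have := no v; rewrite vs => /existsPn /(_ u).
  by rewrite us adj_sym uv.
case/andP: conn => _ /forallP /(_ y) /forallP /(_ x) yx.
by have := closed_connect cl yx; rewrite mem_head (negPf xs).
Qed.

Lemma greedy_rcons x0 s x : greedy x0 s -> s != [::] -> x \notin s ->
  exists y, greedy x0 (rcons s y).
Proof.
move=> [us fs gs] s0 xs; have szs : 0 < size s by case: (s) s0.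
pose l := nth x0 s (size s).-1.
have [y [ys [j js jy] ly]] : exists y, [/\ y \notin s,
    exists2 j, j < size s & adj (nth x0 s j) y &
    adj l y \/ forall y, adj l y -> y \in s].
  case: (boolP [exists y, (y \notin s) && adj l y]) => [/existsP [y /andP [ys ly]] | no].
    exists y; split=> //; last by left.
    by exists (size s).-1 => //; rewrite prednK.
  (* At a dead end, connectedness supplies an unvisited vertex next to a visited one. *)
  have [u [v [us' vs uv]]] := boundary_edge xs s0; exists v; split=> //.
    by exists (index u s); rewrite ?index_mem // nth_index.
  right=> z lz; apply: contraT => zs; case/existsP: no; exists z.
  by rewrite zs.
exists y; split; first by rewrite rcons_uniq ys.
  move=> i; rewrite size_rcons ltnS leq_eqVlt => /orP [/eqP iE | lt].
    by exists j; [rewrite -ltnS iE | rewrite !nth_rcons js iE ltnn eqxx].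
  have [k ki ks] := fs i lt; exists k => //.
  by rewrite !nth_rcons lt (leq_ltn_trans ki (ltnW lt)).
move=> i; rewrite size_rcons ltnS leq_eqVlt => /orP [/eqP iE | lt].
  have -> : take i.+1 (rcons s y) = s by rewrite -cats1 iE take_size_cat.
  by rewrite !nth_rcons -iE ltnSn ltnn eqxx; move: ly; rewrite /l -iE.
rewrite -cats1 takel_cat 1?ltnW // cats1 !nth_rcons lt ltnW //.
exact: gs.
Qed.

Lemma greedy_complete x0 s : greedy x0 s -> s != [::] ->
  exists s', greedy x0 (s ++ s') /\ forall x, x \in s ++ s'.
Proof.
have [n] := ubnP (#|G| - size s); elim: n s => // n IH s lt gs s0.
case: (boolP [forall x, x \in s]) => [/forallP all | /forallPn [x xs]].
  by exists [::]; rewrite cats0.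
have [y gy] := greedy_rcons gs s0 xs.
have le : size (rcons s y) <= #|G|.
  by case: gy => us _ _; rewrite -(card_uniqP us) max_card.
have [||s' [gs' all]] := IH _ _ gy; last 1 first.
- by exists (y :: s'); rewrite -cat_rcons.
- by move: lt le; rewrite size_rcons; lia.
- by rewrite -size_eq0 size_rcons.
Qed.

(** The bound [2 < size t] provides a third vertex, which shows that the second one is no local
    maximum. *)
Lemma longest_path : exists t, [/\ uniq t, sorted (@adj G) t, 2 < size t &
  forall t', uniq t' -> sorted (@adj G) t' -> size t' <= size t].
Proof.
pose P n := [exists t : n.-tuple G, uniq t && sorted (@adj G) t].
have Psz t : uniq t -> sorted (@adj G) t -> P (size t).
  by move=> ut st; apply/existsP; exists (in_tuple t); rewrite /= ut.
have P3 : P 3.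
  case/andP: conn => /card_gt0P [u _] _.
  have := deg2 u; rewrite /degree => /card_gt1P [v [w [+ + vw]]]; rewrite !inE => uv uw.
  apply: (Psz [:: v; u; w]); rewrite /= ?inE ?[adj v u]adj_sym ?uv ?uw //.
  rewrite negb_or vw andbT /= !andbT; apply/andP.
  by split; [apply: contraTneq uv | apply: contraTneq uw] => ->; rewrite adj_irrefl.
have Pbound n : P n -> n <= #|G|.
  case/existsP => t /andP [ut _]; rewrite -(size_tuple t).
  by rewrite -(card_uniqP ut) max_card.
have exP : exists n, P n by exists 3.
have := ex_maxnP exP Pbound => -[m /existsP [t /andP [ut st]] mmax].
exists t; rewrite size_tuple; split=> //; first exact: mmax.
by move=> t' ut' st'; apply: mmax; apply: Psz.
Qed.

Lemma path_greedy x0 t : uniq t -> sorted (@adj G) t -> greedy x0 t.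
Proof.
move=> ut /(sortedP x0) st; split=> // i lt; last by left; apply: st.
by exists i => //; apply: st.
Qed.

Lemma skeleton_of_connected : inhabited (skeleton G).
Proof.
have [t [ut st t3 tmax]] := longest_path.
case: t => [|r [|a [|b t']]] // in ut st t3 tmax *.
set t := [:: r, a, b & t'] in ut st t3 tmax *.
have [s' [[us fs gs] all]] := greedy_complete (path_greedy r ut st) isT.
set s := t ++ s' in us fs gs all.
pose idx u := index u s.
have idxI : injective idx by move=> u v; apply: index_inj.
have idx_t u : u \in t -> idx u = index u t by move=> ut'; rewrite /idx index_cat ut'.
have lt_idx u : idx u < size s by rewrite index_mem.
have nth_idx u : nth r s (idx u) = u by rewrite nth_index.
have idx_nth i : i < size s -> idx (nth r s i) = i by move=> lt; rewrite /idx index_uniq.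
have idx_r : idx r = 0 by rewrite /idx /= eqxx.
have r_min u : idx r <= idx u by rewrite idx_r.
have smaller u : u != r -> exists2 v, adj u v & idx v < idx u.
  move=> ur; have : 0 < idx u.
    by rewrite lt0n -idx_r; apply: contra ur => /eqP /idxI ->.
  case E : (idx u) => [|i] // _; have lti : i.+1 < size s by rewrite -E.
  have [j ji ja] := fs i lti; exists (nth r s j).
    by rewrite adj_sym; move: ja; rewrite -E nth_idx.
  by rewrite idx_nth ?(leq_ltn_trans ji (ltnW lti)) // ltnS.
have succ u v : adj u v -> idx u < idx v -> exists2 y, adj u y & idx y = (idx u).+1.
  move=> uv lt; have lti : (idx u).+1 < size s by apply: leq_ltn_trans lt _.
  have := gs _ lti; rewrite nth_idx => -[uy | no].
    by exists (nth r s (idx u).+1); rewrite ?idx_nth.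
  have := no v uv; rewrite in_take // => ltv.
  by move: lt; rewrite ltnNge -ltnS ltv.
have t_adj i : i.+1 < size t -> adj (nth r t i) (nth r t i.+1).
  by move: st => /(sortedP r); apply.
have ra : adj r a by exact: (t_adj 0).
have ab : adj a b by exact: (t_adj 1).
(* A neighbor off the path of either end would extend a path of maximum length. *)
have in_t_last t1 x : uniq t1 -> sorted (@adj G) t1 -> size t1 = size t ->
    adj (last r t1) x -> x \in t1.
  move=> ut1 st1 sz1 lx; apply: contraT => xt1; have := tmax (rcons t1 x).
  rewrite rcons_uniq xt1 ut1 size_rcons sz1 ltnn.
  case: t1 ut1 st1 sz1 lx xt1 => // y t1 _ st1 _ lx _.
  move=> /(_ isT) H; apply: H; rewrite rcons_cons /= rcons_path.
  by apply/andP.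
have in_t_first y t1 x : uniq (y :: t1) -> sorted (@adj G) (y :: t1) ->
    size (y :: t1) = size t -> adj x y -> x \in y :: t1.
  move=> ut1 st1 sz1 xy; apply: contraT => xt1; have := tmax (x :: y :: t1).
  rewrite cons_uniq xt1 ut1 -sz1 ltnn.
  by rewrite /= xy => /(_ isT st1).
have in_t_r x : adj x r -> x \in t by exact: in_t_first ut st erefl.
have t_nmax x : x \in t -> (idx x).+1 < size t ->
    exists2 y, y \in t & adj x y /\ idx y = (idx x).+1.
  move=> xt lt; exists (nth r t (idx x).+1); first by rewrite mem_nth.
  rewrite (idx_t (nth _ _ _)) ?mem_nth // index_uniq //; split=> //.
  by rewrite -{1}(nth_index r xt) -idx_t // t_adj.
have t_idx x : x \in t -> idx x < size t by move=> xt; rewrite idx_t // index_mem.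
have t_last x : x \in t -> (size t).-1 <= idx x -> x = last r t.
  move=> xt le; have E : idx x = (size t).-1.
    by apply/eqP; rewrite eqn_leq le andbT -ltnS prednK // t_idx.
  by rewrite -(nth_last r) -E idx_t // nth_index.
have lE : idx (last r t) = (size t).-1.
  by rewrite -nth_last idx_t ?mem_nth // index_uniq.
have last_max : locmax idx (last r t).
  apply/forallP => x; apply/implyP => lx; have xt := in_t_last t x ut st erefl lx.
  have lt := t_idx x xt.
  rewrite lE ltn_neqAle -ltnS prednK // lt andbT.
  apply: contraTneq lx => E; rewrite (t_last x xt) ?E //.
  by rewrite adj_irrefl.
apply: (@skeleton_exists G idx r a (nth r t (size t - 2)) deg2 idxI r_min ra smaller succ).
  apply/forallPn; exists b; rewrite ab /= -leqNgt.
  by rewrite -[a]/(nth r s 1) -[b]/(nth r s 2) !idx_nth.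
move=> z x mz zra zx px.
have max_last y : y \in t -> locmax idx y -> y = last r t.
  move=> yt my; apply: t_last => //; rewrite leqNgt; apply/negP => lt.
  have [|w wt [yw wE]] := t_nmax y yt; first by move: lt; case: (size t) => //.
  by have := locmaxP my yw; rewrite wE ltnNge leqnSn.
have Nt : x \in t.
  case: (boolP (z \in t)) => zt.
    by have E := max_last z zt mz; apply: (in_t_last t) => //; rewrite -E.
  (* A local maximum off the path does not see [r], so it sees [a] and can replace [r] in a longest
     path, which then contains all its neighbors. *)
  have za : adj z a.
    move: zra => /orP []; last by rewrite adj_sym.
    by rewrite adj_sym => /in_t_r; rewrite (negPf zt).
  have uz : uniq (z :: behead t).
    rewrite /= -/(behead t); apply/andP; split; last by case/andP: ut.
    by apply: contra zt; rewrite [in X in _ -> X]inE => ->; rewrite orbT.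
  have sz : sorted (@adj G) (z :: behead t) by rewrite /= za; case/andP: st.
  have : x \in z :: behead t by apply: in_t_first uz sz erefl _; rewrite adj_sym.
  rewrite inE => /orP [/eqP E | xt]; first by move: zx; rewrite E adj_irrefl.
  by rewrite inE xt orbT.
have nmx : ~~ locmax idx x by case/andP: px.
have xlt : (idx x).+1 < size t.
  rewrite ltnNge; apply/negP => le; move: nmx.
  by rewrite (t_last x Nt) ?last_max // -ltnS prednK.
have [y yt [xy yE]] := t_nmax x Nt xlt.
(* The successor of [x] on the path lies above the penultimate [x], so it is a local maximum and
   must be the last vertex of the path. *)
have my : locmax idx y.
  case/andP: px => _ /forallP /(_ y) /implyP; apply.
  by rewrite xy yE ltnSn.
have yl := max_last y yt my.
have -> : size t - 2 = idx x by move: lE; rewrite -yl yE; clear; lia.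
by rewrite idx_t // nth_index.
Qed.

End Order.

Theorem theorem16 (R : archiRcfType) (G : sgraph)
    (conn : connected G) (deg2 : 2 <= min_degree G) :
  ((majority_distinguishing_index (md_colorable_ex deg2))%:Z
     <= Num.ceil (Num.sqrt ((max_degree G)%:R : R)) + 5)%R.
Proof.
have degG (u : G) : 2 <= degree u by exact: leq_trans deg2 (min_degree_le u).
pose x : R := Num.sqrt ((max_degree G)%:R).
have x0 : (0 <= x)%R by exact: Num.Theory.sqrtr_ge0.
(* Nonnegativity turns the integer ceiling into a natural number [s]. *)
have : (0 <= Num.ceil x)%R by rewrite Num.Theory.ceil_ge0 // (Order.POrderTheory.lt_le_trans _ x0) // Num.Theory.ltrN10.
rewrite -/x; case E : (Num.ceil x) => [s|//] _.
have degs (u : G) : degree u <= s ^ 2.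
  apply: leq_trans (leq_bigmax u) _; rewrite -/(max_degree G).
  rewrite -(Num.Theory.ler_nat R) GRing.natrX -(@Num.Theory.sqr_sqrtr R (max_degree G)%:R) ?Num.Theory.ler0n //.
  rewrite Num.Theory.ler_sqr ?Num.Theory.nnegrE ?Num.Theory.ler0n // -/x.
  by have := Num.Theory.ceil_ge x; rewrite E.
have [S] := skeleton_of_connected conn degG.
rewrite -PoszD lez_nat /majority_distinguishing_index.
by case: ex_minnP => m _; apply; apply: skeleton_colorable S _ degG degs.
Qed.
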